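(* Let $X_1,X_2,\dots,X_K$ be identically distributed, unbounded, $m$-dependent random variables (with $m$ fixed) having an exponentially-dominated tail. Let $(M_K)$ be positive integers with $M_K\to\infty$ and $M_K/\ln^{\mu}K\to0$ for some $\mu<1$. Then $X_{(K-M_K+1)}/X_{(K)}\to1$ in probability as $K\to\infty$.
   Context: $X_{(j)}$ denotes the $j$-th smallest of $X_1,\dots,X_K$. A sequence is $m$-dependent if for every $s$ the families $(X_k)_{k\le s}$ and $(X_k)_{k>s+m}$ are independent. Exponentially-dominated tail: a random variable $X$ with continuous CDF $F_X$ has an exponentially-dominated tail if there exist $\alpha>0,\beta\in\mathbb R,\lambda>0,\gamma>0$ with $\lim_{x\to\infty}\frac{1-F_X(x)}{\alpha x^{\beta}e^{-\lambda x^{\gamma}}}=1$. *)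

(* Defs.v *)
From HB Require Import structures.
From mathcomp Require Import all_boot all_order all_algebra.
From mathcomp Require Import all_classical all_reals all_analysis.
Set Implicit Arguments. Unset Strict Implicit. Unset Printing Implicit Defensive.
Import Order.TTheory GRing.Theory Num.Theory.
Import numFieldNormedType.Exports.
Local Open Scope classical_set_scope.
Local Open Scope ring_scope.

Definition gen_sigma d (T : measurableType d) (R : realType) (P : probability T R)
  (X : nat -> {RV P >-> R}) (I : set nat) : set (set T) :=
  <<s \bigcup_(i in I) preimage_set_system setT (X i) measurable >>.

Definition indep_events d (T : measurableType d) (R : realType) (P : probability T R)
  (F G : set (set T)) : Prop :=
  forall A B, F A -> G B -> P (A `&` B) = (P A * P B)%E.

Definition m_dependent d (T : measurableType d) (R : realType) (P : probability T R)
  (m : nat) (X : nat -> {RV P >-> R}) : Prop :=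
  forall s : nat, indep_events P (gen_sigma X [set k | (k <= s)%N])
                                 (gen_sigma X [set k | (s + m < k)%N]).

Definition identically_distributed d (T : measurableType d) (R : realType)
  (P : probability T R) (X : nat -> {RV P >-> R}) : Prop :=
  forall i, distribution P (X i) = distribution P (X 0%N).

Definition unbounded_rv d (T : measurableType d) (R : realType)
  (P : probability T R) (Y : {RV P >-> R}) : Prop :=
  forall x : R, (0 < P [set t | (x < Y t)%R])%E.

Definition cdfR d (T : measurableType d) (R : realType)
  (P : probability T R) (Y : {RV P >-> R}) (x : R) : R := fine (cdf Y x).

Definition exp_dominated_tail d (T : measurableType d) (R : realType)
  (P : probability T R) (Y : {RV P >-> R}) : Prop :=
  continuous (fun x : R => cdfR Y x) /\
  exists (alpha beta lambda gamma : R), 0 < alpha /\ 0 < lambda /\ 0 < gamma /\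
    (fun x : R => (1 - cdfR Y x) /
        (alpha * x `^ beta * expR (- (lambda * x `^ gamma))))
      @ +oo --> (1 : R).

(* j-th smallest (1-indexed) element of a list of reals *)
Definition order_stat (R : realType) (s : seq R) (j : nat) : R :=
  nth 0 (sort <=%O s) j.-1.

(* X_{(j)} among X_1, ..., X_K (here indexed X 0, ..., X (K-1)) *)
Definition order_statRV d (T : measurableType d) (R : realType) (P : probability T R)
  (X : nat -> {RV P >-> R}) (K j : nat) : T -> R :=
  fun t => order_stat [seq X i t | i <- iota 0 K] j.

Definition cvg_in_prob d (T : measurableType d) (R : realType) (P : probability T R)
  (Y : nat -> T -> R) (c : R) : Prop :=
  forall eps : R, 0 < eps ->
    (fun K => P [set t | eps <= `| Y K t - c |]) @ \oo --> 0%E.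

(* Main.v *)
(** For 0 < r < 1 there are levels u_K such that K P(X > u_K) <= K^-delta while
    K P(X > r u_K) >= K^delta: the exponential tail G makes G(r x) a smaller power
    of G(x), and the factor x^beta is negligible at this scale. The union bound puts
    X_(K) below u_K, and a second moment estimate, which only uses that events
    more than m indices apart are independent, yields more than K^delta / 2 >= M_K
    exceedances of r u_K. On the intersection r <= X_(K-M_K+1) / X_(K) <= 1. *)

Require Import Defs.
From HB Require Import structures.
From mathcomp Require Import all_boot all_order all_algebra.
From mathcomp Require Import all_classical all_reals all_analysis.
From mathcomp Require Import measurable_realfun ring lra zify.
Set Implicit Arguments. Unset Strict Implicit. Unset Printing Implicit Defensive.
Import Order.TTheory GRing.Theory Num.Theory.
Import numFieldNormedType.Exports.
Local Open Scope classical_set_scope.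
Local Open Scope ring_scope.

(** * Order statistics through exceedance counts *)

Lemma count_gt_sorted (R : realType) (s : seq R) (c : R) (i : nat) :
  sorted <=%O s -> (i < size s)%N ->
  (c < nth 0 s i) = (size s - i <= count (fun x => c < x)%R s)%N.
Proof.
move=> s_sorted i_lt.
have mono := sorted_leq_nth le_trans lexx 0 s_sorted.
apply/idP/idP => [clt|].
  (* If entry [i] exceeds [c], so do all [size s - i] entries from position [i] on. *)
  have: all (fun x => c < x) (drop i s).
    apply/(all_nthP 0) => k; rewrite size_drop nth_drop => k_lt.
    apply: lt_le_trans clt (mono _ _ _ _ _); rewrite ?inE -?ltn_subRL ?leq_addr //.
  rewrite all_count size_drop => /eqP <-.
  by rewrite -[X in (_ <= count _ X)%N](cat_take_drop i s) count_cat leq_addl.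
apply: contraLR; rewrite -leNgt -ltnNge => nth_le.
(* Otherwise the first [i + 1] entries are at most [c], which leaves at most [size s - i - 1]
   exceedances, one too few. *)
have: all (fun x => ~~ (c < x)) (take i.+1 s).
  apply/(all_nthP 0) => k; rewrite size_takel// => k_lt.
  rewrite nth_take// -leNgt; apply: le_trans (mono _ _ _ _ _) nth_le => //.
  by rewrite inE (leq_trans k_lt).
rewrite -[X in (count _ X < _)%N](cat_take_drop i.+1 s) count_cat.
rewrite all_predC has_count -leqNgt leqn0 => /eqP ->.
by apply: (leq_ltn_trans (count_size _ _)); rewrite size_drop ltn_sub2l.
Qed.

(** This turns every comparison of an order statistic with a level into a count of exceedances.
    Ranks start at 1 while positions start at 0, hence the strict inequality on the right. *)
Lemma lt_order_stat (R : realType) (s : seq R) (c : R) (j : nat) :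
  (0 < j <= size s)%N ->
  (c < order_stat s j) = (size s - j < count (fun x => c < x)%R s)%N.
Proof.
move=> /andP[j0 j_le].
have j_lt : (j.-1 < size (sort <=%O s))%N by rewrite size_sort prednK.
rewrite /order_stat (count_gt_sorted _ (sort_le_sorted s) j_lt) size_sort.
by rewrite (permP (permEl (perm_sort _ _))) -[in RHS](prednK j0) subnSK// prednK.
Qed.

(** * Measurability of exceedance counts, order statistics and their ratio *)

Section measurability.
Context d (T : measurableType d) (R : realType) (P : probability T R).
Implicit Types (X : nat -> {RV P >-> R}).

(** A real sum of indicators instead of a natural number, so that it can be squared and
    integrated. *)
Definition exceedances X (K : nat) (c : R) (t : T) : R :=
  \sum_(i < K) \1_[set t | c < X i t] t.

Lemma count_exceedances X K c t :
  (count (fun x => c < x)%R [seq X i t | i <- iota 0 K])%:R = exceedances X K c t.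
Proof.
rewrite /exceedances count_map -sum1_count natr_sum big_mkcond/=.
rewrite -[in LHS](subn0 K) -/(index_iota 0 K) big_mkord; apply: eq_bigr => i _.
rewrite indicE.
have [ci|ci] := boolP (c < X i t); first by rewrite mem_set.
by rewrite memNset //=; apply/negP.
Qed.

Lemma measurable_exceed X i c : measurable [set t | c < X i t].
Proof.
have -> : [set t | c < X i t] = setT `&` X i @^-1` `]c, +oo[.
  by rewrite setTI; apply/seteqP; split => t /=; rewrite in_itv/= andbT.
exact: measurable_funP.
Qed.

Lemma measurable_exceedances X K c : measurable_fun setT (exceedances X K c).
Proof.
by apply: measurable_sum => i; apply: measurable_indic; exact: measurable_exceed.
Qed.

Lemma measurable_order_statRV X K j : measurable_fun setT (order_statRV X K j).
Proof.
(* A position beyond the list returns the default 0, so the map is then constant. Writing [j.-1.+1]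
   also covers [j = 0], which behaves like rank 1. *)
have [j_le|j_gt] := leqP j.-1.+1 K; last first.
  rewrite [order_statRV _ _ _](_ : _ = cst 0)//; apply/funext => t.
  by rewrite /order_statRV /order_stat nth_default// size_sort size_map size_iota -ltnS.
move=> mT; apply: (measurability _ (RGenOInfty.measurableE R)) => //.
(* It suffices to treat the open rays above [c], whose preimages are events on the exceedance
   count. *)
move=> _ [_ [c ->] <-]; rewrite setTI.
rewrite [X in measurable X](_ : _ = setT `&` [set t | (K - j.-1)%:R <= exceedances X K c t]).
  by apply: measurable_fun_le => //; exact: measurable_exceedances.
rewrite setTI; apply/seteqP; split => t/=; rewrite in_itv/= andbT -count_exceedances ler_nat;
  rewrite /order_statRV /order_stat count_gt_sorted ?sort_le_sorted ?size_sort ?size_map ?size_iota//;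
  by rewrite (permP (permEl (perm_sort _ _))).
Qed.

Lemma measurable_lt_level (f : T -> R) (k : R) :
  measurable_fun setT f -> measurable [set t | f t < k].
Proof.
move=> mf; rewrite (_ : mkset _ = ~` (setT `&` [set t | cst k t <= f t])).
  by apply: measurableC; apply: measurable_fun_le.
by rewrite setTI; apply/seteqP; split=> t /=; rewrite ltNge => /negP.
Qed.

Lemma measurable_ratio_deviation (f g : T -> R) (eps : R) :
  measurable_fun setT f -> measurable_fun setT g ->
  measurable [set t | eps <= `|f t / g t - 1|].
Proof.
move=> mf mg.
(* Where [g] vanishes the quotient is 0 by convention, so the deviation equals 1 and the condition
   reads [eps <= 1]. Elsewhere it can be multiplied out by the absolute value of [g], which removes
   the division. *)
rewrite [X in measurable X](_ : _ =
  (setT `&` [set t | `|g t| <= cst 0 t]) `&` [set t | eps <= 1] `|`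
  (~` (setT `&` [set t | `|g t| <= cst 0 t])) `&` (setT `&` [set t | eps * `|g t| <= `|f t - g t|])).
  have m0 : measurable (setT `&` [set t | `|g t| <= cst 0 t]).
    by apply: measurable_fun_le => //; exact: measurableT_comp.
  apply: measurableU; apply: measurableI => //.
  - have [e1|e1] := boolP (eps <= 1).
      by rewrite (_ : mkset _ = setT)//; apply/seteqP; split.
    by rewrite (_ : mkset _ = set0)//; apply/seteqP; split => // t /=; rewrite (negbTE e1).
  - exact: measurableC.
  apply: measurable_fun_le => //.
    by apply: measurable_funM => //; exact: measurableT_comp.
  by apply: measurableT_comp => //; exact: measurable_funB.
apply/seteqP; split => t/=.
  have [g0|g0] := eqVneq (g t) 0.
    by rewrite g0 invr0 mulr0 sub0r normrN normr1 normr0; left.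
  move=> h; right; split; first by case=> _; rewrite normr_le0 (negbTE g0).
  by split => //; rewrite -ler_pdivlMr ?normr_gt0// -normf_div mulrBl divff.
have [g0|g0] := eqVneq (g t) 0.
  rewrite g0 invr0 mulr0 sub0r normrN normr1 normr0 => -[[]//|[h _]].
  by exfalso; apply: h.
move=> [[[_]]|[_ [_]]]; first by rewrite normr_le0 (negbTE g0).
by rewrite -ler_pdivlMr ?normr_gt0// -normf_div mulrBl divff.
Qed.

End measurability.

(** * Second moment estimate for sums of indicators *)

Lemma card_close_indices (K m : nat) (i : 'I_K) :
  (\sum_(j < K | (i <= j + m) && (j <= i + m)) 1 <= (2 * m).+1)%N.
Proof.
(* The indices within distance [m] of [i] lie in a window of length [2m + 1]; the truncated
   subtraction [i - m] starts it at 0 when [i < m]. *)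
rewrite sum1_card cardE -(size_map val) -(size_iota (i - m) (2 * m).+1).
apply: uniq_leq_size; first by rewrite map_inj_uniq ?enum_uniq//; exact: val_inj.
move=> _ /mapP[j + ->]; rewrite mem_enum unfold_in mem_iota => /andP[h1 h2].
by rewrite /= in h1 h2 *; apply/andP; split; lia.
Qed.

Section second_moment.
Context d (T : measurableType d) (R : realType) (P : probability T R).

Lemma integral_sum_indic (I : Type) (s : seq I) (A : I -> set T) :
  (forall i, measurable (A i)) ->
  (\int[P]_x (\sum_(i <- s) \1_(A i) x)%:E = \sum_(i <- s) P (A i))%E.
Proof.
move=> mA; under eq_integral do rewrite -sumEFin.
rewrite ge0_integral_sum//.
- by apply: eq_bigr => i _; rewrite integral_indic// setIT.
- by move=> i; apply/measurable_EFinP.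
Qed.

(** Only pairs at distance at most [m] can be correlated, at most [2m + 1] for each index, so the
    variance of the sum is at most [2m + 1] times its mean [e = K p]. A value below [k <= e / 2]
    deviates from the mean by at least [e / 2], and Chebyshev's bound is of order [1 / e]. *)
Lemma second_moment_lower_tail (A : nat -> set T) (p k : R) (m K : nat) :
  (forall i, measurable (A i)) ->
  (forall i, P (A i) = p%:E) ->
  (forall i j, (i + m < j)%N -> P (A i `&` A j) = (p * p)%:E) ->
  0 < K%:R * p -> k <= K%:R * p / 2 ->
  (P [set t | (\sum_(i < K) \1_(A i) t < k)%R] <=
   (4 * (2 * m).+1%:R / (K%:R * p))%:E)%E.
Proof.
move=> mA PA PAA; set e := K%:R * p => e_gt0 k_le.
pose N t := \sum_(i < K) \1_(A i) t : R.
have mN : measurable_fun setT N by apply: measurable_sum => i; exact: measurable_indic.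
pose B := [set t | N t < k]; rewrite -/B.
have mB : measurable B by exact: measurable_lt_level.
have N_ge0 t : 0 <= N t by apply: sumr_ge0 => i _; rewrite indicE.
have PN : (\int[P]_t (N t)%:E = e%:E)%E.
  rewrite /N integral_sum_indic//; under eq_bigr do rewrite PA.
  by rewrite sumEFin sumr_const card_ord /e mulr_natl.
have N2E t : N t ^+ 2 = \sum_(ij : 'I_K * 'I_K) \1_(A ij.1 `&` A ij.2) t.
  rewrite expr2 /N big_distrlr/= pair_big/=; apply: eq_bigr => -[i j] _ /=.
  by rewrite indicI.
have p_ge0 : 0 <= p by rewrite -lee_fin -(PA 0%N).
pose q i j := fine (P (A i `&` A j)).
have qE i j : P (A i `&` A j) = (q i j)%:E.
  by rewrite fineK// fin_num_measure//; exact: measurableI.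
(* Distant pairs give exactly [p * p]; a close pair is bounded by the probability [p] of one of its
   events. *)
have q_le i j : q i j <= p * p + p * ((i <= j + m)%N && (j <= i + m)%N)%:R.
  have [ij|] := leqP i (j + m); have [ji|] := leqP j (i + m) => /=.
  - rewrite mulr1 -[leLHS]add0r lerD ?mulr_ge0// -lee_fin -qE -(PA i).
    by apply: le_measure; rewrite ?inE//; exact: measurableI.
  - by move/PAA => h; rewrite /q h mulr0 addr0.
  - by move/PAA; rewrite setIC => h; rewrite /q h mulr0 addr0.
  - by move=> h _; rewrite /q setIC; rewrite setIC PAA// mulr0 addr0.
have PN2 : (\int[P]_t (N t ^+ 2)%:E <= (e ^+ 2 + e * (2 * m).+1%:R)%:E)%E.
  under eq_integral do rewrite N2E.
  rewrite integral_sum_indic; last by move=> ij; exact: measurableI.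
  under eq_bigr do rewrite qE.
  rewrite sumEFin lee_fin -(pair_big xpredT xpredT (fun i j : 'I_K => q i j))/=.
  apply: (@le_trans _ _ (\sum_(i < K) (K%:R * (p * p) + p * (2 * m).+1%:R))).
    apply: ler_sum => i _; apply: le_trans; first by apply: ler_sum => j _; exact: q_le.
    rewrite big_split/= sumr_const card_ord mulr_natl lerD2l -mulr_sumr ler_wpM2l//.
    by rewrite -natr_sum ler_nat -big_mkcond card_close_indices.
  by rewrite sumr_const card_ord -mulr_natl /e; lra.
(* Integrating this one-sided bound gives Chebyshev's inequality at k <= e / 2
   without any integrability side condition. *)
have pointwise t : (e ^+ 2 / 4) * \1_B t + (2 * e) * N t <= N t ^+ 2 + e ^+ 2.
  rewrite indicE; have [|_] := boolP (t \in B); last by have := sqr_ge0 (N t - e); rewrite mulr0; nra.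
  rewrite inE /B/= mulr1 => Nk.
  have e2 : e / 2 <= e - N t by lra.
  have h : (e / 2) ^+ 2 <= (e - N t) ^+ 2 by rewrite ler_sqr ?nnegrE; lra.
  by nra.
have : (\int[P]_t ((e ^+ 2 / 4) * \1_B t + (2 * e) * N t)%:E <=
        \int[P]_t (N t ^+ 2 + e ^+ 2)%:E)%E.
  apply: ge0_le_integral => //.
  - by move=> t _; rewrite lee_fin addr_ge0// mulr_ge0 ?indicE ?divr_ge0 ?sqr_ge0// mulr_ge0// ltW.
  - by apply/measurable_EFinP; apply: measurable_funD; apply: measurable_funM.
  - by apply/measurable_EFinP; apply: measurable_funD => //; exact: measurable_funX.
  - by move=> t _; rewrite lee_fin pointwise.
under eq_integral do rewrite EFinD (EFinM (e ^+ 2 / 4)) (EFinM (2 * e)).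
rewrite ge0_integralD//; last 4 first.
- by move=> t _; rewrite -EFinM lee_fin mulr_ge0 ?indicE ?divr_ge0 ?sqr_ge0.
- by apply/measurable_EFinP; apply: measurable_funM.
- by move=> t _; rewrite -EFinM lee_fin !mulr_ge0// ltW.
- by apply/measurable_EFinP; apply: measurable_funM.
rewrite ge0_integralZl//; last 2 first.
- by apply/measurable_EFinP.
- by rewrite lee_fin divr_ge0 ?sqr_ge0.
rewrite ge0_integralZl//; last 3 first.
- by apply/measurable_EFinP.
- by move=> t _; rewrite lee_fin.
- by rewrite lee_fin mulr_ge0// ltW.
have PBE : P B = (fine (P B))%:E by rewrite fineK// fin_num_measure.
have -> : (\int[P]_t (\1_B t)%:E = (fine (P B))%:E)%E.
  by rewrite integral_indic// setIT -PBE.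
rewrite PN PBE.
under [X in (_ <= X)%E -> _]eq_integral do rewrite EFinD.
rewrite ge0_integralD//; last 3 first.
- by move=> t _; rewrite lee_fin sqr_ge0.
- by apply/measurable_EFinP; exact: measurable_funX.
- by move=> t _; rewrite lee_fin sqr_ge0.
have -> : (\int[P]_t (e ^+ 2)%:E = (e ^+ 2)%:E)%E.
  by rewrite integral_cst//= [X in (_ * X)%E](probability_setT P) mule1.
move=> /le_trans/(_ (leeD2r _ PN2)).
(* Here [h] reads [e^2/4 P(B) + 2 e^2 <= 2 e^2 + e (2m + 1)]; the terms [2 e^2] cancel and one
   factor [e] is divided out. *)
rewrite -!EFinM -!EFinD !lee_fin => h.
rewrite ler_pdivlMr// -(ler_pM2l e_gt0); lra.
Qed.

End second_moment.

(** * Asymptotics of the tail and choice of the levels *)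

Lemma ln_le_powR_near (R : realType) (b c eta gamma : R) :
  0 < eta -> 0 < gamma ->
  \forall x \near +oo, b * ln x + c <= eta * x `^ gamma.
Proof.
move=> eta0 gamma0.
have w0 : 0 < eta * gamma ^+ 2 by rewrite mulr_gt0// exprn_gt0.
(* The summand 1 gives [ln x >= 1], which lets the constant [c] be absorbed into a multiple of
   [ln x]; the other summand is where the quadratic bound below overtakes the linear one. *)
pose s0 := 1 + 2 * (`|b| + `|c|) / (eta * gamma ^+ 2).
near=> x.
have x_ge : expR s0 <= x by near: x; apply: nbhs_pinfty_ge; rewrite num_real.
have x0 : 0 < x by apply: (lt_le_trans _ x_ge); exact: expR_gt0.
have s_ge : s0 <= ln x by rewrite -[s0]expRK ler_ln ?posrE// expR_gt0.
have s_ge1 : 1 <= ln x.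
  apply: (le_trans _ s_ge); rewrite /s0 lerDl.
  by apply: divr_ge0; [rewrite mulr_ge0 ?addr_ge0|exact: ltW].
have ln0 : 0 <= ln x by exact: le_trans ler01 s_ge1.
have lin : 2 * (`|b| + `|c|) <= (eta * gamma ^+ 2) * ln x.
  by rewrite [leRHS]mulrC -ler_pdivrMr//; apply: (le_trans _ s_ge); rewrite /s0 lerDr.
(* Since [x^gamma = exp(gamma ln x)], the quadratic term of the exponential series is a lower
   bound. *)
have quad : (gamma * ln x) ^+ 2 / 2 <= x `^ gamma.
  rewrite /powR gt_eqF//; have g0 : 0 <= gamma * ln x by rewrite mulr_ge0 ?(ltW gamma0).
  by apply: le_trans (expR_ge1Dxn 1 g0); rewrite lerDr.
have b_le : b * ln x <= `|b| * ln x by rewrite ler_wpM2r ?ler_norm.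
have c_le : c <= `|c| * ln x.
  by rewrite (le_trans (ler_norm c))// ler_peMr.
apply: (@le_trans _ _ ((`|b| + `|c|) * ln x)); first by rewrite mulrDl lerD.
apply: (@le_trans _ _ (eta * ((gamma * ln x) ^+ 2 / 2))); last by rewrite ler_pM2l.
have := ler_wpM2r ln0 lin; lra.
Unshelve. all: by end_near. Qed.

Section tail.
Context d (T : measurableType d) (R : realType) (P : probability T R).

(** Both [alpha * x^beta] and the factor 2 lost in passing from the limit to an inequality have
    logarithm of order at most [ln x], so an arbitrarily small fraction [delta] of the exponent
    [lambda * x^gamma] absorbs them. *)
Lemma exp_dominated_tail_bounds (Y : {RV P >-> R}) :
  exp_dominated_tail Y -> exists lambda gamma : R, [/\ 0 < lambda, 0 < gamma &
    forall delta : R, 0 < delta -> \forall x \near +oo,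
      expR (- ((1 + delta) * (lambda * x `^ gamma))) <= 1 - cdfR Y x
      <= expR (- ((1 - delta) * (lambda * x `^ gamma)))].
Proof.
case=> _ [alpha [beta [lambda [gamma [alpha0 [lambda0 [gamma0 tail]]]]]]].
exists lambda, gamma; split => // delta delta0.
have dl0 : 0 < delta * lambda by rewrite mulr_gt0.
near=> x.
have x0 : 0 < x by near: x; exact: nbhs_pinfty_gt.
have up : beta * ln x + (ln 2 + ln alpha) <= delta * lambda * x `^ gamma.
  by near: x; exact: ln_le_powR_near.
have lo : - beta * ln x + (ln 2 - ln alpha) <= delta * lambda * x `^ gamma.
  by near: x; exact: ln_le_powR_near.
have DE : alpha * x `^ beta * expR (- (lambda * x `^ gamma)) =
    expR (ln alpha + beta * ln x - lambda * x `^ gamma).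
  by rewrite !expRD lnK ?posrE// {1}/powR gt_eqF.
have D0 : 0 < alpha * x `^ beta * expR (- (lambda * x `^ gamma)).
  by rewrite DE expR_gt0.
have two : 2 = expR (ln 2) :> R by rewrite lnK ?posrE.
have ratio_lt : (1 - cdfR Y x) /
    (alpha * x `^ beta * expR (- (lambda * x `^ gamma))) < 2.
  by near: x; apply: (cvgr_lt _ tail); rewrite ltr1n.
have ratio_gt : 2^-1 < (1 - cdfR Y x) /
    (alpha * x `^ beta * expR (- (lambda * x `^ gamma))).
  by near: x; apply: (cvgr_gt _ tail); lra.
apply/andP; split.
  apply: (@le_trans _ _ (2^-1 * (alpha * x `^ beta * expR (- (lambda * x `^ gamma))))); last first.
    by rewrite -ler_pdivlMr// ltW.
  by rewrite DE two -expRN -expRD ler_expR; lra.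
apply: (@le_trans _ _ (2 * (alpha * x `^ beta * expR (- (lambda * x `^ gamma))))).
  by rewrite -ler_pdivrMr// ltW.
by rewrite DE two -expRD ler_expR; lra.
Unshelve. all: by end_near. Qed.

End tail.

Lemma ln_natr_cvgy (R : realType) : (fun n => ln (n%:R : R)) @ \oo --> +oo.
Proof.
apply/cvgryPge => A; near=> n.
have n_ge : expR A <= n%:R by near: n; exact: nbhs_infty_ger.
by rewrite -[A]expRK ler_ln ?posrE ?expR_gt0// (lt_le_trans _ n_ge) ?expR_gt0.
Unshelve. all: by end_near. Qed.

Lemma powR_cvgy (R : realType) (a : R) : 0 < a -> x `^ a @[x --> +oo] --> +oo.
Proof.
move=> a0; apply/cvgryPge => A; near=> x.
have x_ge : (1 + `|A|) `^ a^-1 <= x.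
  by near: x; apply: nbhs_pinfty_ge; rewrite num_real.
have A1 : 0 <= 1 + `|A| by rewrite addr_ge0.
apply: (@le_trans _ _ (1 + `|A|)).
  by rewrite (le_trans (ler_norm A))// lerDr.
rewrite -[leLHS]powRr1// -(mulVf (lt0r_neq0 a0)) powRrM.
by rewrite ge0_ler_powR// ?nnegrE ?powR_ge0 ?(le_trans _ x_ge) ?powR_ge0 ?ltW.
Unshelve. all: by end_near. Qed.

Lemma scale_cvgy (R : realType) (c : R) (u : nat -> R) :
  0 < c -> u @ \oo --> +oo -> (fun n => c * u n) @ \oo --> +oo.
Proof.
move=> c0 uy; apply/cvgryPge => A; near=> n.
by rewrite mulrC -ler_pdivrMr//; near: n; exact: (cvgry_ge uy).
Unshelve. all: by end_near. Qed.

(** The level solves [u^gamma = b ln K], which makes both tails powers of [K]. Replacing [u] by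
    [r u] multiplies the exponent by [rho = r^gamma < 1], and this gap outweighs the errors
    [1 + delta] and [1 - delta] of the tail bounds. The power [K^delta] is written
    [exp(delta ln K)]. *)
Lemma tail_levels d (T : measurableType d) (R : realType) (P : probability T R)
    (Y : {RV P >-> R}) (r : R) : exp_dominated_tail Y -> 0 < r < 1 ->
  exists delta : R, 0 < delta /\ exists u : nat -> R, \forall K \near \oo,
    [/\ 0 < u K, K%:R * (1 - cdfR Y (u K)) <= expR (- (delta * ln K%:R)) &
      expR (delta * ln K%:R) <= K%:R * (1 - cdfR Y (r * u K))].
Proof.
move=> /exp_dominated_tail_bounds[lambda [gamma [lambda0 gamma0 tail]]] /andP[r0 r1].
(* delta is chosen so that rho (1 + delta)^2 <= (1 - delta)^2. *)
pose rho := r `^ gamma; pose delta := (1 - rho) / 4.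
have rho0 : 0 < rho by exact: powR_gt0.
have rho1 : rho < 1.
  rewrite [ltRHS](_ : 1 = 1 `^ gamma); last by rewrite powR1.
  by rewrite gt0_ltr_powR// nnegrE ltW.
have delta0 : 0 < delta by rewrite /delta; lra.
have delta1 : delta < 1 by rewrite /delta; lra.
(* With this [b] the upper tail bound at [u K] is exactly [K^-(1 + delta)]. *)
pose b := (1 + delta) / ((1 - delta) * lambda).
have b0 : 0 < b by rewrite divr_gt0 ?mulr_gt0 ?subr_gt0// addr_gt0.
exists delta; split => //; pose u (K : nat) : R := (b * ln K%:R) `^ gamma^-1.
exists u.
have u_cvgy : u @ \oo --> +oo.
  have inner : (fun K => b * ln (K%:R : R)) @ \oo --> +oo.
    by apply: scale_cvgy => //; exact: ln_natr_cvgy.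
  have gammaV0 : 0 < gamma^-1 by rewrite invr_gt0.
  exact: (cvg_comp _ _ inner (powR_cvgy gammaV0)).
have ru_cvgy : (fun K => r * u K) @ \oo --> +oo by exact: scale_cvgy.
near=> K.
have u0 : 0 < u K by near: K; exact: (cvgry_gt u_cvgy).
have lnK0 : 0 < ln (K%:R : R) by near: K; exact: (cvgry_gt (@ln_natr_cvgy R)).
have K0 : 0 < K%:R :> R.
  by rewrite ltNge; apply/negP => K0; have := ln_le0 (le_trans K0 ler01); lra.
have KE : K%:R = expR (ln K%:R) :> R by rewrite lnK ?posrE.
have uE : u K `^ gamma = b * ln K%:R.
  by rewrite /u -powRrM mulVf ?gt_eqF// powRr1// mulr_ge0 ?ltW.
have /andP[_ tail_u] : expR (- ((1 + delta) * (lambda * u K `^ gamma))) <= 1 - cdfR Y (u K)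
      <= expR (- ((1 - delta) * (lambda * u K `^ gamma))).
  by near: K; exact: u_cvgy (tail _ delta0).
have /andP[tail_ru _] : expR (- ((1 + delta) * (lambda * (r * u K) `^ gamma))) <=
    1 - cdfR Y (r * u K) <= expR (- ((1 - delta) * (lambda * (r * u K) `^ gamma))).
  by near: K; exact: ru_cvgy (tail _ delta0).
have bE : (1 - delta) * (lambda * b) = 1 + delta.
  by rewrite /b mulrA mulrC divfK// mulf_neq0 ?gt_eqF// subr_gt0.
split => //.
  apply: (le_trans (ler_wpM2l (ltW K0) tail_u)).
  rewrite {1}KE -expRD ler_expR uE.
  have -> : (1 - delta) * (lambda * (b * ln K%:R)) = (1 - delta) * (lambda * b) * ln K%:R by ring.
  by rewrite bE; lra.
apply: le_trans (ler_wpM2l (ltW K0) tail_ru).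
rewrite {2}KE -expRD ler_expR powRM ?(ltW r0) ?(ltW u0)// uE -/rho.
have -> : (1 + delta) * (lambda * (rho * (b * ln K%:R))) = (1 + delta) * rho * (lambda * b) * ln K%:R by ring.
(* The lower tail bound at [r u] is [K] to the power minus the left side; multiplied by [1 - delta],
   the inequality becomes the one that fixed [delta]. *)
suff : (1 + delta) * rho * (lambda * b) <= 1 - delta by move=> /(ler_wpM2r (ltW lnK0)); lra.
have d1 : 0 < 1 - delta by rewrite subr_gt0.
rewrite -(ler_pM2l d1).
have -> : (1 - delta) * ((1 + delta) * rho * (lambda * b)) = (1 + delta) * rho * ((1 - delta) * (lambda * b)) by ring.
rewrite bE (_ : rho = 1 - 4 * delta); last by rewrite /delta; field.
rewrite -subr_ge0 [leRHS](_ : _ = 8 * delta ^+ 2 + 4 * delta ^+ 3); last by ring.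
by have := exprn_ge0 2 (ltW delta0); have := exprn_ge0 3 (ltW delta0); lra.
Unshelve. all: by end_near. Qed.

(** * From exceedance counts to the ratio of order statistics *)

Lemma top_ratio_close (R : realType) (s : seq R) (u r : R) (M : nat) :
  0 < u -> 0 < r -> (0 < M)%N ->
  (count (fun x => u < x)%R s = 0)%N ->
  (M <= count (fun x => r * u < x)%R s)%N ->
  `|order_stat s (size s - M + 1) / order_stat s (size s) - 1| <= 1 - r.
Proof.
move=> u0 r0 M0 no_high enough.
have M_le : (M <= size s)%N by apply: leq_trans enough _; exact: count_size.
set y := order_stat s (size s - M + 1); set x := order_stat s (size s).
(* Rank [size s - M + 1] leaves [M - 1] larger ranks, so [M] exceedances of [r * u] are just
   enough. *)
have y_gt : r * u < y by rewrite lt_order_stat; lia.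
have x_le : x <= u by rewrite leNgt lt_order_stat ?no_high; lia.
have y_le : y <= x.
  rewrite leNgt lt_order_stat; last lia.
  apply/negP => h; suff : x < x by rewrite ltxx.
  by rewrite {2}/x lt_order_stat; lia.
have x0 : 0 < x by apply: lt_le_trans y_le; apply: lt_trans y_gt; rewrite mulr_gt0.
have yx_le1 : y / x <= 1 by rewrite ler_pdivrMr ?mul1r.
have r_le : r <= y / x.
  rewrite ler_pdivlMr//; apply: le_trans (ltW y_gt); rewrite ler_pM2l//.
by rewrite ler0_norm ?subr_le0//; lra.
Qed.

Section exceedance_probability.
Context d (T : measurableType d) (R : realType) (P : probability T R).
Context (X : nat -> {RV P >-> R}).

Lemma prob_exceed (c : R) (i : nat) : identically_distributed X ->
  P [set t | c < X i t] = (1 - cdfR (X 0%N) c)%:E.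
Proof.
move=> idX; transitivity (ccdf (X 0%N) c).
  rewrite /ccdf -(idX i) /distribution /pushforward; congr (P _).
  by apply/seteqP; split => t /=; rewrite in_itv/= andbT.
have := cdf_ccdf_1 (X 0%N) c.
have : cdf (X 0%N) c \is a fin_num by rewrite fin_num_measure.
have : ccdf (X 0%N) c \is a fin_num by rewrite fin_num_measure.
rewrite /cdfR; case: (cdf _ _) (ccdf _ _) => [a||] [b||]//= _ _.
by rewrite -EFinD => -[<-]; congr (_%:E); rewrite addrAC subrr add0r.
Qed.

(** The dependence hypothesis is cut at [s = i]: the two events are generators of the past up to [i]
    and of the future beyond [i + m]. *)
Lemma prob_exceedI (c p : R) (m i j : nat) : m_dependent m X -> (i + m < j)%N ->
  P [set t | c < X i t] = p%:E -> P [set t | c < X j t] = p%:E ->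
  P ([set t | c < X i t] `&` [set t | c < X j t]) = (p * p)%:E.
Proof.
move=> depX ij Pi Pj; rewrite (depX i) ?Pi ?Pj//.
- apply: sub_sigma_algebra; exists i => //=; exists `]c, +oo[%classic => //.
  by rewrite setTI; apply/seteqP; split => t /=; rewrite in_itv/= andbT.
- apply: sub_sigma_algebra; exists j => //=; exists `]c, +oo[%classic => //.
  by rewrite setTI; apply/seteqP; split => t /=; rewrite in_itv/= andbT.
Qed.

Lemma prob_some_exceed_le (c : R) (K : nat) : identically_distributed X ->
  (P (\big[setU/set0]_(i < K) [set t | (c < X i t)%R]) <=
   (K%:R * (1 - cdfR (X 0%N) c))%:E)%E.
Proof.
move=> idX.
apply: le_trans (_ : _ <= \sum_(i < K) P [set t | (c < X i t)%R])%E _.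
  by apply: (@Boole_inequality _ _ _ P (fun i => [set t | c < X i t])) => i _; exact: measurable_exceed.
under eq_bigr do rewrite prob_exceed//.
by rewrite sumEFin sumr_const card_ord mulr_natl.
Qed.

Lemma ratio_deviation_prob_le (m K M : nat) (u r eps : R) :
  identically_distributed X -> m_dependent m X -> (0 < M)%N ->
  0 < u -> 0 < r -> 1 - r < eps ->
  0 < K%:R * (1 - cdfR (X 0%N) (r * u)) ->
  M%:R <= K%:R * (1 - cdfR (X 0%N) (r * u)) / 2 ->
  (P [set t | (eps <= `|order_statRV X K (K - M + 1) t / order_statRV X K K t - 1|)%R] <=
   (K%:R * (1 - cdfR (X 0%N) u) +
    4 * (2 * m).+1%:R / (K%:R * (1 - cdfR (X 0%N) (r * u))))%:E)%E.
Proof.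
move=> idX depX M0 u0 r0 r_eps e0 M_le.
set p := 1 - cdfR (X 0%N) (r * u) in e0 M_le *.
pose high := \big[setU/set0]_(i < K) [set t | u < X i t].
pose few := [set t | exceedances X K (r * u) t < M%:R].
have mhigh : measurable high.
  by apply: bigsetU_measurable => i _; exact: measurable_exceed.
have mfew : measurable few by apply: measurable_lt_level; exact: measurable_exceedances.
(* Off [high] and [few] the deterministic estimate bounds the deviation by [1 - r < eps], so a large
   deviation forces one of the two events. *)
apply: (@le_trans _ _ (P (high `|` few))).
  apply: le_measure; rewrite ?inE.
  - by apply: measurable_ratio_deviation; exact: measurable_order_statRV.
  - exact: measurableU.
  move=> t /=; apply: contraPP => /not_orP[not_high not_few].
  apply/negP; rewrite -ltNge; apply: le_lt_trans r_eps.
  have sz : K = size [seq X i t | i <- iota 0 K] by rewrite size_map size_iota.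
  rewrite /order_statRV [in X in order_stat _ X]sz [in X in _ / order_stat _ X]sz.
  apply: (@top_ratio_close R _ u) => //.
    apply/eqP; rewrite -leqn0 leqNgt -has_count; apply/hasPn => _ /mapP[i + ->].
    rewrite mem_iota => /andP[_ iK]; apply/negP => ui; apply: not_high.
    by rewrite /high -(bigcup_mkord K (fun i => [set t | u < X i t])); exists i.
  by rewrite -(@ler_nat R) count_exceedances leNgt; apply/negP.
apply: (le_trans (measureU2 _ mhigh mfew)).
rewrite EFinD leeD//; first exact: prob_some_exceed_le.
apply: (@second_moment_lower_tail _ _ _ P (fun i => [set t | r * u < X i t]) p) => //.
- by move=> i; exact: measurable_exceed.
- by move=> i; exact: prob_exceed.
- by move=> i j ij; apply: prob_exceedI depX ij _ _; exact: prob_exceed.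
Qed.

End exceedance_probability.

(** * Growth of [M] and conclusion *)

Lemma le_expR_ln_near (R : realType) (delta mu : R) (M : nat -> nat) :
  0 < delta -> mu < 1 ->
  (fun K => (M K)%:R / (ln (K%:R : R)) `^ mu) @ \oo --> (0 : R) ->
  \forall K \near \oo, (M K)%:R <= expR (delta * ln (K%:R : R)) / 2.
Proof.
move=> delta0 mu1 M_small; near=> K.
have L_ge1 : 1 <= ln (K%:R : R) by near: K; apply: cvgry_ge; exact: ln_natr_cvgy.
(* Past this threshold [2 L <= (delta L)^2 / 2] for [L = ln K], and the right side is below
   [exp(delta L)]. *)
have L_ge : 4 / delta ^+ 2 <= ln (K%:R : R).
  by near: K; apply: cvgry_ge; exact: ln_natr_cvgy.
have L0 : 0 < ln (K%:R : R) by exact: lt_le_trans L_ge1.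
have M_lt : (M K)%:R / (ln (K%:R : R)) `^ mu < 1.
  by near: K; apply: (cvgr_lt _ M_small); exact: ltr01.
have M_le : (M K)%:R <= ln (K%:R : R).
  move: M_lt; rewrite ltr_pdivrMr ?powR_gt0// mul1r => /ltW/le_trans; apply.
  by apply: ler1_powR => //; exact: ltW.
apply: (le_trans M_le); rewrite ler_pdivlMr//.
have dL0 : 0 <= delta * ln (K%:R : R) by rewrite mulr_ge0 ?(ltW delta0) ?(ltW L0).
apply: (@le_trans _ _ (1 + (delta * ln K%:R) ^+ 2 / 2)); last exact: (expR_ge1Dxn 1 dL0).
have : 4 * ln (K%:R : R) <= delta ^+ 2 * ln (K%:R : R) ^+ 2.
  move: L_ge; rewrite ler_pdivrMr ?exprn_gt0// => /(ler_wpM2r (ltW L0)).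
  by rewrite expr2; lra.
by rewrite exprMn; lra.
Unshelve. all: by end_near. Qed.

Theorem mainTheorem7 (d : measure_display) (T : measurableType d) (R : realType)
  (P : probability T R) (X : nat -> {RV P >-> R}) (m : nat) (M : nat -> nat) :
  identically_distributed X ->
  unbounded_rv (X 0%N) ->
  m_dependent m X ->
  exp_dominated_tail (X 0%N) ->
  (forall K, (0 < M K)%N) ->
  (fun K => (M K)%:R : R) @ \oo --> +oo ->
  (exists mu : R, mu < 1 /\
     (fun K => (M K)%:R / (ln (K%:R : R)) `^ mu) @ \oo --> (0 : R)) ->
  cvg_in_prob P
    (fun K t => order_statRV X K (K - M K + 1) t / order_statRV X K K t) 1.
Proof.
move=> idX _ depX tailX M0 _ [mu [mu1 M_small]] eps eps0.
(* Unlike [1 - eps], this lies in [(0, 1)] for every positive [eps], and [1 - r = r * eps < eps]. *)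
pose r := (1 + eps)^-1.
have r0 : 0 < r by rewrite invr_gt0 addr_gt0.
have r1 : r < 1 by rewrite invf_lt1 ?addr_gt0// ltrDl.
have r_eps : 1 - r < eps.
  have rE : r * (1 + eps) = 1 by rewrite mulVf// gt_eqF// addr_gt0.
  by have := mulr_gt0 r0 eps0; nra.
have r01 : 0 < r < 1 by rewrite r0.
have [delta [delta0 [u levels]]] := tail_levels tailX r01.
have M_le := le_expR_ln_near delta0 mu1 M_small.
(* The 1 comes from the union bound and the rest from the second moment bound; each is multiplied by
   [K^-delta]. *)
pose C : R := 1 + 4 * (2 * m).+1%:R.
apply: (@squeeze_cvge _ _ _ _ (cst 0%E) _ (fun K => (C * expR (- (delta * ln (K%:R : R))))%:E)).
- near=> K; rewrite measure_ge0/=.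
  have [u0 high low] : [/\ 0 < u K,
      K%:R * (1 - cdfR (X 0%N) (u K)) <= expR (- (delta * ln (K%:R : R))) &
      expR (delta * ln (K%:R : R)) <= K%:R * (1 - cdfR (X 0%N) (r * u K))].
    by near: K.
  have M_leK : (M K)%:R <= expR (delta * ln (K%:R : R)) / 2 by near: K.
  have e0 := lt_le_trans (expR_gt0 _) low.
  apply: le_trans; first apply: (@ratio_deviation_prob_le _ _ _ _ _ m _ _ (u K) r) => //.
    by apply: (le_trans M_leK); rewrite ler_pM2r.
  rewrite lee_fin /C [leRHS]mulrDl mul1r lerD// ler_wpM2l//.
  by rewrite expRN lef_pV2 ?posrE// expR_gt0.
- exact: cvg_cst.
- apply: cvg_EFin; first by near=> K.
  rewrite -(mulr0 C); apply: cvgMl_tmp.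
  exact: (cvg_comp _ _ (scale_cvgy delta0 (@ln_natr_cvgy R)) (@cvgr_expR R)).
Unshelve. all: by end_near. Qed.
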